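(* Let $U\subseteq\mathbb{R}^n$ be open, $0\le k\le n$ and let $r\ge 0$ be an integer. The linear map $\Psi_r:(\hat{\mathcal B}_k^r(U))'\to\mathcal B_k^r(U)$ determined by $\Psi_r(X)(p;\alpha):=X(p;\alpha)$ (for $p\in U$ and $k$-vectors $\alpha$) is a topological isomorphism. Furthermore, $\|\Psi_r(X)\|_{B^r}=\|X\|_{B^r}$ for all $X\in(\hat{\mathcal B}_k^r(U))'$, where $\|X\|_{B^r}$ denotes the dual (operator) norm of $X$.
   Context: Let $U\subseteq\mathbb{R}^n$ be open, fix an inner product on $\mathbb{R}^n$, and let $\Lambda_k$ be the $k$-th exterior power of $\mathbb{R}^n$. The mass of a simple $k$-vector $\alpha=v_1\wedge\cdots\wedge v_k$ is $\|\alpha\|=\sqrt{\det(\langle v_i,v_j\rangle)}$; for a general $k$-vector, $\|\alpha\|=\inf\{\sum_i\|\alpha_i\|:\alpha_i\text{ simple},\ \alpha=\sum_i\alpha_i\}$. $\mathcal A_k(U)$ (Dirac $k$-chains) is the vector space of finitely supported functions $U\to\Lambda_k$, written as finite formal sums $\sum_i(p_i;\alpha_i)$, $p_i\in U$, $\alpha_i\in\Lambda_k$. Let $T_u(p;\alpha)=(p+u;\alpha)$, $\Delta_u=T_u-I$. For a list $\sigma^j=\{u_1,\dots,u_j\}$ of vectors put $\Delta_{\sigma^j}(p;\alpha)=\Delta_{u_j}\circ\cdots\circ\Delta_{u_1}(p;\alpha)$ and $\|\sigma^j\|=\|u_1\|\cdots\|u_j\|$; for $j=0$, $\Delta_{\emptyset}(p;\alpha)=(p;\alpha)$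 and $\|\sigma^0\|=1$. $\Delta_{\sigma^j}(p;\alpha)$ is inside $U$ if the convex hull of its support is contained in $U$. For $A\in\mathcal A_k(U)$, $$\|A\|_{B^r}=\inf\Big\{\sum_i\|\sigma_i^{j(i)}\|\|\alpha_i\| : A=\sum_i\Delta_{\sigma_i^{j(i)}}(p_i;\alpha_i)\ \text{(finite sum)},\ 0\le j(i)\le r,\ \text{each term inside }U\Big\}.$$ This is a norm; $\hat{\mathcal B}_k^r(U)$ is the completion of $\mathcal A_k(U)$ in it, and $(\hat{\mathcal B}_k^r(U))'$ is its continuous dual. For a linear functional $\omega$ on $\mathcal A_k(U)$ (a differential $k$-form) let $|\omega|_{B^j}=\sup\{|\omega(\Delta_{\sigma^j}(p;\alpha))| : \|\sigma^j\|\|\alpha\|=1,\ \Delta_{\sigma^j}(p;\alpha)\text{ inside }U\}$ and $\|\omega\|_{B^r}=\max\{|\omega|_{B^0},\dots,|\omega|_{B^r}\}$. $\mathcal B_k^r(U)$ is the normed space of those $\omega$ with $\|\omega\|_{B^r}<\infty$. *)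

(* Defs.v *)
From HB Require Import structures.
From mathcomp Require Import all_boot all_order all_algebra perm sesquilinear.
From mathcomp Require Import all_classical all_reals all_analysis.

From mathcomp Require Import zify.

Set Implicit Arguments.
Unset Strict Implicit.
Unset Printing Implicit Defensive.

Import Order.TTheory GRing.Theory Num.Theory.
Import numFieldNormedType.Exports.

Local Open Scope classical_set_scope.
Local Open Scope ring_scope.

Definition increasing n k (f : {ffun 'I_k -> 'I_n}) : bool :=
  [forall i : 'I_k, forall j : 'I_k, (i < j)%N ==> (f i < f j)%N].

Definition multi_index n k := {f : {ffun 'I_k -> 'I_n} | increasing f}.

(* Coordinates in the basis e_I = e_(I 0) /\ ... /\ e_(I (k-1)). *)
Definition kvector (R : realType) n k := {ffun multi_index n k -> R^o}.

(* v_1, ..., v_k are the rows of V; the e_I-coordinate of v_1 /\ ... /\ v_k is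
   the minor of V on the columns I. *)
Definition wedge (R : realType) n k (V : 'M[R]_(k, n)) : kvector R n k :=
  [ffun I : multi_index n k => \det (colsub (val I) V) : R^o].

Section mass.
Variables (R : realType) (n : nat) (g : {dot 'rV[R]_n for idfun}).

Definition vnorm (u : 'rV[R]_n) : R := Num.sqrt (g u u).

Definition gram k (V : 'M[R]_(k, n)) : 'M[R]_k :=
  \matrix_(i, j) g (row i V) (row j V).

(* (c, V) stands for the simple k-vector c *: wedge V. The coefficient c can be
   absorbed in V when 0 < k; it makes every 0-vector, i.e., scalar, simple. *)
Definition simple_mass k (t : R * 'M[R]_(k, n)) : R :=
  `|t.1| * Num.sqrt (\det (gram t.2)).

Definition mass k (a : kvector R n k) : R :=
  inf [set \sum_(t <- s) simple_mass t |
        s in [set s : seq (R * 'M[R]_(k, n)) |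
               a = \sum_(t <- s) t.1 *: wedge t.2]].

End mass.

Section mass_theory.
Variables (R : realType) (n : nat) (g : {dot 'rV[R]_n for idfun}).

Let G : 'M[R]_n := \matrix_(i, j) g (delta_mx 0 i) (delta_mx 0 j).

Let dotC u v : g u v = g v u.
Proof. by rewrite hermC expr0 mul1r. Qed.

Let dotDl u v w : g (u + v) w = g u w + g v w. Proof. exact: linearDl. Qed.
Let dotZl a u w : g (a *: u) w = a * g u w. Proof. exact: linearZl_LR. Qed.
Let dot0l w : g 0 w = 0. Proof. by rewrite -[0](scale0r 0) dotZl mul0r. Qed.
Let dotDr u v w : g w (u + v) = g w u + g w v.
Proof. by rewrite dotC dotDl !(dotC w). Qed.
Let dotZr a u w : g w (a *: u) = a * g w u.
Proof. by rewrite dotC dotZl dotC. Qed.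
Let dot0r w : g w 0 = 0. Proof. by rewrite dotC dot0l. Qed.
Let dot_suml I (r : seq I) P (F : I -> 'rV[R]_n) w :
  g (\sum_(i <- r | P i) F i) w = \sum_(i <- r | P i) g (F i) w.
Proof. by elim/big_rec2: _ => [|i x y _ <-]; rewrite ?dot0l ?dotDl. Qed.
Let dot_sumr I (r : seq I) P (F : I -> 'rV[R]_n) w :
  g w (\sum_(i <- r | P i) F i) = \sum_(i <- r | P i) g w (F i).
Proof. by rewrite dotC dot_suml; apply: eq_bigr => i _; rewrite dotC. Qed.

Let dot_ge0 u : 0 <= g u u.
Proof.
have [->|u0] := eqVneq u 0; first by rewrite dot0l.
exact/ltW/neq0_dnorm_gt0.
Qed.

Let dot_eq0 u : g u u = 0 -> u = 0.
Proof.
move=> gu; apply/eqP; apply/negPn/negP => /(@neq0_dnorm_gt0 _ _ _ g).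
by rewrite gu ltxx.
Qed.

Let dotE u v : g u v = (u *m G *m v^T) 0 0.
Proof.
rewrite {1}(row_sum_delta u) {1}(row_sum_delta v) dot_suml mxE.
under eq_bigr do rewrite dot_sumr.
rewrite exchange_big; apply: eq_bigr => j _; rewrite !mxE mulr_suml.
by apply: eq_bigr => i _; rewrite dotZl dotZr !mxE; rewrite mulrA mulrAC.
Qed.

Let gramE k (V : 'M[R]_(k, n)) : gram g V = V *m G *m V^T.
Proof.
apply/matrixP => i j; rewrite mxE dotE -row_mul !mxE.
by apply: eq_bigr => l _; rewrite !mxE.
Qed.

Let gram_mul k (L : 'M[R]_k) (V : 'M[R]_(k, n)) :
  gram g (L *m V) = L *m gram g V *m L^T.
Proof. by rewrite !gramE trmx_mul !mulmxA. Qed.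

Let gram_schmidt k (V : 'M[R]_(k, n)) : exists2 L : 'M[R]_k, \det L = 1 &
  forall i j, i != j -> g (row i (L *m V)) (row j (L *m V)) = 0.
Proof.
elim: k V => [|k IH] V; first by exists 1%:M; rewrite ?det1// => -[].
rewrite -[k.+1]/(1 + k)%N in V *; rewrite -[V]vsubmxK.
set v := usubmx V; set V' := dsubmx V.
have [L detL oL] := IH V'; set W := L *m V'.
pose c : 'rV[R]_k := \row_i (g v (row i W) / g (row i W) (row i W)).
pose L' : 'M[R]_(1 + k) := block_mx 1%:M (- (c *m L)) 0 L.
have EL : L' *m col_mx v V' = col_mx (v - c *m W) W.
  by rewrite mul_block_col mul1mx mul0mx add0r mulNmx -mulmxA.
exists L'; first by rewrite det_ublock det1 detL mul1r.
rewrite EL.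
have key j : g (v - c *m W) (row j W) = 0.
  rewrite dotDl -scaleN1r dotZl mulN1r mulmx_sum_row dot_suml (bigD1 j)//= big1.
    rewrite addr0 dotZl mxE; have [w0|w0] := eqVneq (g (row j W) (row j W)) 0.
      by rewrite (dot_eq0 w0) !dot0r mulr0 subrr.
    by rewrite divfK// subrr.
  by move=> i ij; rewrite dotZl oL ?mulr0.
move=> i j; rewrite -(splitK i) -(splitK j).
case: (fintype.split i) => i'; case: (fintype.split j) => j' /=.
- by rewrite !ord1 eqxx.
- by move=> _; rewrite rowKu rowKd row_id key.
- by move=> _; rewrite rowKu rowKd row_id dotC key.
- by move=> ij; rewrite !rowKd oL//; apply: contra_neq ij => ->.
Qed.

Let det_gram k (V : 'M[R]_(k, n)) :
  (forall i j, i != j -> g (row i V) (row j V) = 0) ->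
  \det (gram g V) = \prod_i g (row i V) (row i V).
Proof.
move=> oV; suff -> : gram g V = diag_mx (\row_i g (row i V) (row i V)).
  by rewrite det_diag; apply: eq_bigr => i _; rewrite mxE.
apply/matrixP => i j; rewrite !mxE.
by have [->|ij] := eqVneq i j; rewrite ?mulr1n// mulr0n oV.
Qed.

Lemma det_gram_ge0 k (V : 'M[R]_(k, n)) : 0 <= \det (gram g V).
Proof.
have [L dL oL] := gram_schmidt V.
suff -> : \det (gram g V) = \det (gram g (L *m V)).
  by rewrite det_gram//; apply: prodr_ge0.
by rewrite gram_mul !det_mulmx det_tr dL mul1r mulr1.
Qed.

Let coord_le : exists2 C : R, 0 <= C & forall (u : 'rV[R]_n) j, `|u 0 j| <= C * vnorm g u.
Proof.
have [L dL oL] := gram_schmidt 1%:M; move: oL; rewrite mulmx1 => oL.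
have uL : L \in unitmx by rewrite unitmxE dL unitr1.
have d0 i : 0 < g (row i L) (row i L).
  rewrite lt_neqAle dot_ge0 andbT eq_sym; apply/eqP => /dot_eq0 r0.
  have := congr1 (mulmx^~ (invmx L)) r0; rewrite -row_mul mulmxV// mul0mx.
  by move/rowP/(_ i); rewrite !mxE eqxx => /eqP; rewrite oner_eq0.
pose C := \sum_(i < n) \sum_(j < n) `|L i j| / Num.sqrt (g (row i L) (row i L)).
exists C; first by do 2 apply: sumr_ge0 => ? _; rewrite divr_ge0// sqrtr_ge0.
move=> u j; pose a := u *m invmx L.
have uE : u = a *m L by rewrite mulmxKV.
have aE i : a 0 i ^+ 2 * g (row i L) (row i L) <= g u u.
  have -> : g u u = \sum_i a 0 i ^+ 2 * g (row i L) (row i L).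
    rewrite uE mulmx_sum_row dot_suml; apply: eq_bigr => l _.
    rewrite dot_sumr (bigD1 l)//= big1 ?addr0 => [|m ml].
      by rewrite dotZl dotZr mulrA.
    by rewrite dotZl dotZr oL ?mulr0// eq_sym.
  rewrite (bigD1 i)//= lerDl sumr_ge0// => m _.
  by rewrite mulr_ge0// sqr_ge0.
have aE' i : `|a 0 i| <= vnorm g u / Num.sqrt (g (row i L) (row i L)).
  rewrite ler_pdivlMr ?sqrtr_gt0//.
  by rewrite -sqrtr_sqr -sqrtrM ?sqr_ge0// ler_sqrt.
have -> : u 0 j = \sum_i a 0 i * L i j by rewrite {1}uE mxE.
rewrite (le_trans (ler_norm_sum _ _ _))// /C mulr_suml; apply: ler_sum => i _.
rewrite normrM (le_trans (ler_wpM2r _ (aE' i)))//.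
rewrite mulr_suml (bigD1 j)//= -[leLHS]addr0 lerD//.
  by rewrite -mulrA [X in _ * X]mulrC [leRHS]mulrC.
apply: sumr_ge0 => l _; rewrite mulr_ge0 ?sqrtr_ge0// divr_ge0// sqrtr_ge0.
Qed.

Let minor_le k : exists2 C : R, 0 <= C & forall (V : 'M[R]_(k, n)) (I : multi_index n k),
  `|wedge V I| <= C * Num.sqrt (\det (gram g V)).
Proof.
have [C C0 leC] := coord_le.
exists (\sum_(s : 'S_k) C ^+ k).
  by apply: sumr_ge0 => s _; rewrite exprn_ge0.
move=> V I; rewrite ffunE.
have [L dL oL] := gram_schmidt V.
have -> : \det (colsub (val I) V) = \det (colsub (val I) (L *m V)).
  suff -> : colsub (val I) (L *m V) = L *m colsub (val I) V.
    by rewrite det_mulmx dL mul1r.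
  by apply/matrixP => i j; rewrite !mxE; apply: eq_bigr => l _; rewrite !mxE.
have -> : \det (gram g V) = \det (gram g (L *m V)).
  by rewrite gram_mul !det_mulmx det_tr dL mul1r mulr1.
move: {V dL} (L *m V) oL => V oV.
rewrite det_gram// (_ : Num.sqrt _ = \prod_i vnorm g (row i V)); last first.
  elim/big_rec2: _ => [|i x y _ <-]; first by rewrite sqrtr1.
  by rewrite sqrtrM// dot_ge0.
rewrite /determinant (le_trans (ler_norm_sum _ _ _))// mulr_suml.
apply: ler_sum => s _; rewrite normrM normrX normrN1 expr1n mul1r normr_prod.
rewrite -[X in C ^+ X](card_ord k) -prodr_const -big_split/=.
apply: ler_prod => i _; rewrite normr_ge0 mxE/=.
by have := leC (row i V) (val I (s i)); rewrite mxE.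
Qed.

Let wedge_basis k (I : multi_index n k) :
  wedge (\matrix_(i, j) (val I i == j)%:R : 'M[R]_(k, n)) =
  [ffun J => (I == J)%:R].
Proof.
apply/ffunP => J; rewrite !ffunE.
have incr (K : multi_index n k) (i j : 'I_k) : (i < j)%N -> (val K i < val K j)%N.
  by case: K => K /= /forallP/(_ i)/forallP/(_ j)/implyP; apply.
have inj (K : multi_index n k) : injective (val K).
  move=> i j Kij; apply/val_inj/eqP; rewrite eqn_leq.
  by apply/andP; split; rewrite leqNgt; apply/negP => /(incr K); rewrite Kij ltnn.
have [<-|IJ] := eqVneq I J.
  rewrite (_ : colsub _ _ = 1%:M) ?det1//.
  by apply/matrixP => i j; rewrite !mxE (inj_eq (inj I)).
have [i nJi] : exists i, forall j, val I i != val J j.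
  apply: contra_neqP IJ => /forallNP H.
  have /choice[s sE] : forall i, exists j, val I i = val J j.
    by move=> i; have /existsNP[j /negP/negPn/eqP] := H i; exists j.
  have sincr (i j : 'I_k) : (i < j)%N -> (s i < s j)%N.
    move=> ij; rewrite ltnNge; apply/negP; rewrite leq_eqVlt => /orP[/eqP/val_inj e|].
      by have := incr I _ _ ij; rewrite !sE e ltnn.
    by move=> /(incr J); rewrite -!sE; have := incr I _ _ ij; lia.
  have s_ge m : forall i : 'I_k, i = m :> nat -> (i <= s i)%N.
    elim: m => [i ->//|m IH i im].
    have mk : (m < k)%N by rewrite ltnW// -im.
    have /= := IH (Ordinal mk) erefl.
    by have /= := sincr (Ordinal mk) i; rewrite im => /(_ (ltnSn m)); lia.
  have s_le m : forall i : 'I_k, (k - i)%N = m -> (s i <= i)%N.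
    elim: m => [i|m IH i im]; first by have := ltn_ord i; lia.
    have [ik|ik] := ltnP i.+1 k; last by have := ltn_ord (s i); lia.
    have := IH (Ordinal ik); have := sincr i (Ordinal ik) => /=.
    by move=> /(_ (ltnSn i)) + /(_ ltac:(lia)); lia.
  apply/val_inj/ffunP => i; rewrite sE; congr (val J _).
  by apply/val_inj/eqP; rewrite eqn_leq (s_le _ i erefl) (s_ge _ i erefl).
rewrite (expand_det_row _ i) big1// => j _.
by rewrite !mxE (negPf (nJi j)) mul0r.
Qed.

Lemma wedge_span k (a : kvector R n k) :
  exists s : seq (R * 'M[R]_(k, n)), a = \sum_(t <- s) t.1 *: wedge t.2.
Proof.
exists (map (fun I : multi_index n k =>
    (a I : R, \matrix_(i, j) (val I i == j)%:R : 'M[R]_(k, n)))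
  (enum {: multi_index n k})).
rewrite big_map big_enum/=; apply/ffunP => J.
rewrite sum_ffunE (bigD1 J)//= big1 ?addr0 => [|I IJ]; rewrite ffunE.
  rewrite [X in _ *: X](_ : _ = 1) ?[RHS]mulr1//.
  by rewrite wedge_basis ffunE eqxx.
rewrite [X in _ *: X](_ : _ = 0) ?[LHS]mulr0//.
by rewrite wedge_basis ffunE (negPf IJ).
Qed.

Let mass_set k (a : kvector R n k) : set R :=
  [set \sum_(t <- s) simple_mass g t |
        s in [set s : seq (R * 'M[R]_(k, n)) |
               a = \sum_(t <- s) t.1 *: wedge t.2]].

Let mass_has_inf k (a : kvector R n k) : has_inf (mass_set a).
Proof.
split; first by have [s sE] := wedge_span a; exists (\sum_(t <- s) simple_mass g t), s.
exists 0 => _ [s _ <-]; apply: sumr_ge0 => t _.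
by rewrite mulr_ge0// sqrtr_ge0.
Qed.

Lemma mass_ge0 k (a : kvector R n k) : 0 <= mass g a.
Proof.
apply: lb_le_inf; first by case: (mass_has_inf a).
move=> _ [s _ <-]; apply: sumr_ge0 => t _; by rewrite mulr_ge0// sqrtr_ge0.
Qed.

Let massZ_le k c (a : kvector R n k) : mass g (c *: a) <= `|c| * mass g a.
Proof.
apply/ler_addgt0Pr => e e0.
have ce : 0 < e / (`|c| + 1) by rewrite divr_gt0// ltr_wpDl.
have [_ [s sE <-] ls] := inf_adherent ce (mass_has_inf a).
have : mass g (c *: a) <= `|c| * \sum_(t <- s) simple_mass g t.
  apply: ge_inf; first by case: (mass_has_inf (c *: a)).
  exists [seq (c * t.1, t.2) | t <- s].
    rewrite /= big_map {1}sE scaler_sumr; apply: eq_bigr => t _.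
    by rewrite scalerA.
  rewrite big_map mulr_sumr; apply: eq_bigr => t _.
  by rewrite /simple_mass normrM mulrA.
move=> /le_trans; apply.
rewrite (le_trans (ler_wpM2l _ (ltW ls)))// mulrDr lerD2l.
rewrite mulrCA -[leRHS]mulr1 ler_wpM2l ?(ltW e0)//.
by rewrite ler_pdivrMr ?mul1r ?lerDl// ltr_wpDl.
Qed.

Lemma massZ k c (a : kvector R n k) : mass g (c *: a) = `|c| * mass g a.
Proof.
apply/eqP; rewrite eq_le massZ_le/=.
have [->|c0] := eqVneq c 0; first by rewrite normr0 mul0r mass_ge0.
rewrite -ler_pdivlMl ?normr_gt0// -normfV.
by rewrite -{1}(scalerK c0 a) massZ_le.
Qed.

Lemma mass_eq0 k (a : kvector R n k) : mass g a = 0 -> a = 0.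
Proof.
move=> a0; have [C C0 leC] := minor_le k.
apply/ffunP => I; rewrite ffunE; apply/eqP; rewrite -normr_le0.
apply/ler_addgt0Pr => e e0; rewrite add0r.
have ce : 0 < e / (C + 1) by rewrite divr_gt0// ltr_wpDl.
have [_ [s sE <-] ls] := inf_adherent ce (mass_has_inf a).
move: ls; rewrite [inf _]a0 add0r => ls.
have : `|a I| <= C * \sum_(t <- s) simple_mass g t.
  rewrite {1}sE sum_ffunE (le_trans (ler_norm_sum _ _ _))// mulr_sumr.
  apply: ler_sum => t _; rewrite ffunE normrM /simple_mass mulrCA.
  by rewrite ler_wpM2l// leC.
move=> /le_trans; apply.
rewrite (le_trans (ler_wpM2l _ (ltW ls)))//.
rewrite mulrCA -[leRHS]mulr1 ler_wpM2l ?(ltW e0)//.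
by rewrite ler_pdivrMr ?mul1r ?lerDl// ltr_wpDl.
Qed.

End mass_theory.

Section ambient_chains.
Variables (R : realType) (n k : nat).
Implicit Types f : 'rV[R]_n -> kvector R n k.

Definition supp f : set 'rV[R]_n := [set x | f x != 0].

(* The element (p; a), as a function on all of R^n. *)
Definition elem (p : 'rV[R]_n) (a : kvector R n k) : 'rV[R]_n -> kvector R n k :=
  fun x => if x == p then a else 0.

Definition translate (u : 'rV[R]_n) f : 'rV[R]_n -> kvector R n k :=
  fun x => f (x - u).

Definition Delta1 (u : 'rV[R]_n) f : 'rV[R]_n -> kvector R n k :=
  translate u f - f.

Definition Delta (sigma : seq 'rV[R]_n) f : 'rV[R]_n -> kvector R n k :=
  foldl (fun h u => Delta1 u h) f sigma.

Definition convex_hull (A : set 'rV[R]_n) : set 'rV[R]_n :=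
  \bigcap_(C in [set C : set (convex_lmodType 'rV[R]_n) |
                  convex_set C /\ A `<=` C]) C.

Definition inside (U : set 'rV[R]_n) f := convex_hull (supp f) `<=` U.

End ambient_chains.

Section dirac_chains.
Variables (R : realType) (n k : nat) (U : set 'rV[R]_n).

Definition dchain_pred (f : 'rV[R]_n -> kvector R n k) : bool :=
  `[< finite_set (supp f) /\ supp f `<=` U >].

(* A function U -> Lambda_k is represented by its extension by 0 to R^n. *)
Record dchain := DChain {
  dchain_fun :> 'rV[R]_n -> kvector R n k ;
  dchain_funP : dchain_pred dchain_fun }.

HB.instance Definition _ := [isSub for dchain_fun].
HB.instance Definition _ := [Choice of dchain by <:].

Lemma dchain_pred_submod : subsemimod_closed dchain_pred.
Proof.
split; first split.
- have sub : supp (0 : 'rV[R]_n -> kvector R n k) `<=` set0.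
    by move=> x; rewrite /supp/= /GRing.zero/= eqxx.
  apply/asboolP; split; first exact: sub_finite_set sub (finite_set0 _).
  by move=> x /sub.
- move=> f h /asboolP[ff fU] /asboolP[fh hU]; apply/asboolP.
  have sub : supp (f + h) `<=` supp f `|` supp h.
    move=> x /= fhx; have [fx|fx] := eqVneq (f x) 0; last by left.
    by right; apply: contraNneq fhx => hx; rewrite /GRing.add/= fx hx addr0.
  split; last by move=> x /sub[/fU|/hU].
  by apply: (sub_finite_set sub); rewrite finite_setU.
- move=> c f /asboolP[ff fU]; apply/asboolP.
  have sub : supp (c *: f) `<=` supp f.
    move=> x /=; apply: contraNneq => fx.
    by rewrite /GRing.scale/= fx scaler0.
  by split; [exact: sub_finite_set sub _|move=> x /sub/fU].
Qed.

HB.instance Definition _ :=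
  GRing.isSubmodClosed.Build R ('rV[R]_n -> kvector R n k) dchain_pred
    dchain_pred_submod.
HB.instance Definition _ := [SubChoice_isSubLmodule of dchain by <:].

Lemma elem_dchain (p : U) a : dchain_pred (elem (val p) a).
Proof.
have sub : supp (elem (val p) a) `<=` [set val p].
  move=> x; rewrite /supp/= /elem.
  by have [->//|_] := eqVneq x (val p); rewrite eqxx.
apply/asboolP; split; first exact: sub_finite_set sub (finite_set1 _).
by move=> _ /sub ->; exact: set_valP.
Qed.

Definition dirac_elem (p : U) (a : kvector R n k) : dchain :=
  DChain (elem_dchain p a).

End dirac_chains.

Section norms.
Variables (R : realType) (n k : nat) (g : {dot 'rV[R]_n for idfun}).
Variable U : set 'rV[R]_n.

Definition list_norm (sigma : seq 'rV[R]_n) : R := \prod_(u <- sigma) vnorm g u.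

(* (sigma, p, a) stands for Delta_sigma (p; a). The point p need not be required
   to be in U: if the chain is nonzero, p is in the convex hull of its support. *)
Definition term (t : seq 'rV[R]_n * 'rV[R]_n * kvector R n k) :=
  Delta t.1.1 (elem t.1.2 t.2).

Definition bnorm (r : nat) (A : dchain k U) : R :=
  inf [set \sum_(t <- s) list_norm t.1.1 * mass g t.2 |
        s in [set s : seq (seq 'rV[R]_n * 'rV[R]_n * kvector R n k) |
          {in s, forall t, (size t.1.1 <= r)%N /\ inside U (term t)} /\
          (A : 'rV[R]_n -> kvector R n k) = \sum_(t <- s) term t]].

(* A term inside U belongs to A_k(U), hence is the value of some A : dchain. *)
Definition unit_terms (j : nat) : set (dchain k U) :=
  [set A | exists sigma p a, [/\ size sigma = j,
     (A : 'rV[R]_n -> kvector R n k) = term (sigma, p, a),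
     inside U (term (sigma, p, a)) & list_norm sigma * mass g a = 1]].

(* 0 is adjoined so that the supremum is 0, not -oo, over an empty set. *)
Definition form_seminorm (j : nat) (w : dchain k U -> R) : \bar R :=
  ereal_sup (0%E |` [set `|w A|%:E | A in unit_terms j]).

Definition form_norm (r : nat) (w : dchain k U -> R) : \bar R :=
  \big[maxe/0%E]_(j < r.+1) form_seminorm j w.

End norms.

Section form_norm_theory.
Variables (R : realType) (n k : nat) (g : {dot 'rV[R]_n for idfun}).
Variables (U : set 'rV[R]_n) (r : nat).
Implicit Types w : dchain k U -> R.

Lemma form_norm_ge0 w : (0 <= form_norm g r w)%E.
Proof. by rewrite /form_norm; elim/big_rec: _ => // i x _; rewrite le_max orbC => ->. Qed.

Lemma form_normP w (M : R) : 0 <= M ->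
  (form_norm g r w <= M%:E)%E <->
  (forall j A, (j <= r)%N -> unit_terms g j A -> `|w A| <= M).
Proof.
move=> M0; split=> [wM j A jr jA|wM].
  rewrite -lee_fin; apply: le_trans wM.
  rewrite /form_norm (bigD1 (Ordinal (jr : (j < r.+1)%N)))//= le_max.
  by apply/orP; left; apply: ereal_sup_ubound; right; exists A.
rewrite /form_norm; elim/big_rec: _ => [|j x _ xM]; first by rewrite lee_fin.
rewrite ge_max xM andbT; apply: ge_ereal_sup => _ [->|[A jA <-]].
  by rewrite lee_fin.
by rewrite lee_fin (wM j)// -ltnS.
Qed.

Lemma form_norm_lt_pinfty w : (form_norm g r w < +oo)%E <->
  exists2 M, 0 <= M &
    forall j A, (j <= r)%N -> unit_terms g j A -> `|w A| <= M.
Proof.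
split=> [|[M M0 /form_normP-/(_ M0)/le_lt_trans->//]]; last exact: ltry.
have := form_norm_ge0 w; case wM : (form_norm g r w) => [M| |]//.
rewrite lee_fin => M0 _; exists M => //.
by apply/form_normP => //; rewrite wM.
Qed.

Lemma dchain_split w : linear (w : dchain k U -> R^o) ->
  (forall p a, w (dirac_elem p a) = 0) -> forall A, w A = 0.
Proof.
move=> lw w0 A.
pose W : {linear dchain k U -> R^o} := HB.pack (w : dchain k U -> R^o)
  (GRing.isLinear.Build _ _ _ _ _ lw).
have wB B C : w (B - C) = w B - w C by exact: (linearB W).
have /asboolP[/finite_seqP[s As] _] := dchain_funP A.
have {As} : supp A `<=` [set` s] by rewrite As.
elim: s A => [|p s IH] A sub.
  have -> : A = 0; last exact: (linear0 W).
  apply/val_inj/funext => x; apply/eqP/negPn/negP => Ax.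
  by have := sub x Ax; rewrite /= in_nil.
have [Ap|Ap] := eqVneq (dchain_fun A p) 0.
  apply: IH => x Ax; have := sub x Ax; rewrite /= inE => /predU1P[xp|//].
  by move: Ax; rewrite /supp/= xp Ap eqxx.
have Up : U p by have /asboolP[_] := dchain_funP A; apply.
pose q : U := SigSub (mem_set Up).
have <- : w (A - dirac_elem q (dchain_fun A p)) = w A by rewrite wB w0 subr0.
apply: IH => x Ax; have [xp|xp] := eqVneq x p.
  move: Ax; rewrite /supp/= /GRing.add/= /GRing.opp/= /elem xp eqxx.
  by rewrite subrr eqxx.
have : supp A x.
  move: Ax; rewrite /supp/= /GRing.add/= /GRing.opp/= /elem (negPf xp).
  by rewrite subr0.
by move=> /sub; rewrite /= inE (negPf xp).
Qed.

End form_norm_theory.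

Section bounded_forms.
Variables (R : realType) (n k : nat) (g : {dot 'rV[R]_n for idfun}).
Variables (r : nat) (U : set 'rV[R]_n).

Definition bform_pred (w : dchain k U -> R^o) : bool :=
  `[< linear w /\ (form_norm g r w < +oo)%E >].

Record bform := BForm {
  bform_fun :> dchain k U -> R^o ;
  bform_funP : bform_pred bform_fun }.

HB.instance Definition _ := [isSub for bform_fun].
HB.instance Definition _ := [Choice of bform by <:].

Lemma bform_pred_submod : subsemimod_closed bform_pred.
Proof.
split; first split.
- apply/asboolP; split; first by move=> c A B; rewrite /GRing.zero/= scaler0 addr0.
  apply/form_norm_lt_pinfty; exists 0 => // j A _ _.
  by rewrite /GRing.zero/= normr0.
- move=> w w' /asboolP[lw /form_norm_lt_pinfty[M M0 wM]].
  move=> /asboolP[lw' /form_norm_lt_pinfty[M' M'0 w'M]]; apply/asboolP; split.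
    move=> c A B; rewrite -[LHS]/(w (c *: A + B) + w' (c *: A + B)) lw lw'.
    by rewrite addrACA -scalerDr.
  apply/form_norm_lt_pinfty; exists (M + M'); first exact: addr_ge0.
  move=> j A jr jA; rewrite /GRing.add/= (le_trans (ler_normD _ _))//.
  by rewrite lerD ?(wM j)// (w'M j).
- move=> c w /asboolP[lw /form_norm_lt_pinfty[M M0 wM]]; apply/asboolP; split.
    move=> d A B; rewrite -[LHS]/(c *: w (d *: A + B)) lw scalerDr.
    by rewrite scalerA mulrC -scalerA.
  apply/form_norm_lt_pinfty; exists (`|c| * M); first exact: mulr_ge0.
  move=> j A jr jA; rewrite /GRing.scale/= normrM.
  by rewrite ler_wpM2l// (wM j).
Qed.

HB.instance Definition _ :=
  GRing.isSubmodClosed.Build R (dchain k U -> R^o) bform_pred bform_pred_submod.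
HB.instance Definition _ := [SubChoice_isSubLmodule of bform by <:].

Lemma bform_linear (w : bform) : linear w.
Proof. by have /asboolP[] := bform_funP w. Qed.

HB.instance Definition _ (w : bform) :=
  GRing.isLinear.Build R (dchain k U) R^o _ (bform_fun w) (bform_linear w).

Definition bform_norm (w : bform) : R := fine (form_norm g r w).

Lemma bform_normE (w : bform) : (bform_norm w)%:E = form_norm g r w.
Proof.
have /asboolP[_ fw] := bform_funP w; rewrite /bform_norm fineK//.
by rewrite ge0_fin_numE// form_norm_ge0.
Qed.

Let bform_norm_ge0 w : 0 <= bform_norm w.
Proof. by rewrite -lee_fin bform_normE form_norm_ge0. Qed.

Let bform_normP (w : bform) (M : R) : 0 <= M ->
  bform_norm w <= M <->
  (forall j A, (j <= r)%N -> unit_terms g j A -> `|w A| <= M).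
Proof. by move=> M0; rewrite -lee_fin bform_normE; exact: form_normP. Qed.

Let bform_norm_le (w : bform) j A :
  (j <= r)%N -> unit_terms g j A -> `|w A| <= bform_norm w.
Proof. by move: j A; apply/bform_normP. Qed.

Let bform_normD w w' : bform_norm (w + w') <= bform_norm w + bform_norm w'.
Proof.
apply/bform_normP => [|j A jr jA]; first by rewrite addr_ge0 ?bform_norm_ge0.
rewrite (le_trans (ler_normD _ _))//.
by rewrite lerD// (@bform_norm_le _ j).
Qed.

Let bform_normZ_le c w : bform_norm (c *: w) <= `|c| * bform_norm w.
Proof.
apply/bform_normP => [|j A jr jA]; first by rewrite mulr_ge0 ?bform_norm_ge0.
by rewrite [leLHS]normrM ler_wpM2l// (@bform_norm_le _ j).
Qed.

Let bform_normZ c w : bform_norm (c *: w) = `|c| * bform_norm w.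
Proof.
apply/eqP; rewrite eq_le bform_normZ_le/=.
have [->|c0] := eqVneq c 0; first by rewrite normr0 mul0r bform_norm_ge0.
rewrite -ler_pdivlMl ?normr_gt0// -normfV.
by rewrite -{1}(scalerK c0 w) bform_normZ_le.
Qed.

Let convex_hull_set1 (p : 'rV[R]_n) : convex_hull [set p] `<=` [set p].
Proof.
move=> x; apply; split=> //= y z l; rewrite !inE => -> ->.
exact: (@convmm R (convex_lmodType 'rV[R]_n) l p).
Qed.

Let bform_norm_eq0 w : bform_norm w = 0 -> w = 0.
Proof.
move=> w0; apply/val_inj/funext => A; rewrite [RHS]/=.
apply: (dchain_split (bform_linear w)) => p a.
have [->|a0] := eqVneq a 0.
  rewrite [dirac_elem _ _](_ : _ = 0) ?linear0//.
  by apply/val_inj/funext => x /=; rewrite /elem if_same.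
have ma : mass g a != 0 by apply: contra_neq a0; exact: mass_eq0.
have -> : dirac_elem p a = mass g a *: dirac_elem p ((mass g a)^-1 *: a).
  apply/val_inj/funext => x /=; rewrite /elem /GRing.scale/=.
  by case: ifP => _; rewrite ?scaler0// scalerA divff// scale1r.
rewrite linearZ/= (_ : w _ = 0) ?scaler0//.
apply/eqP; rewrite -normr_le0 -[leRHS]w0; apply: (@bform_norm_le _ 0%N) => //.
exists [::], (val p), ((mass g a)^-1 *: a); split=> //.
  apply: (@subset_trans _ [set val p]); last first.
    by move=> _ ->; exact: set_valP.
  apply: subset_trans (@convex_hull_set1 (val p)).
  move=> x hx C [cC Csub]; apply: hx; split=> // y.
  rewrite /supp/= /term/= /elem; have [-> _|_] := eqVneq y (val p).
    exact: Csub.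
  by rewrite eqxx.
rewrite /list_norm big_nil mul1r massZ ger0_norm ?invr_ge0 ?mass_ge0//.
by rewrite mulVf.
Qed.

HB.instance Definition _ := Lmodule_isNormed.Build R bform
  bform_normD bform_normZ bform_norm_eq0.

End bounded_forms.

Section dual.
Variables (R : realType) (V : normedModType R).

Definition dual_pred (X : V -> R^o) : bool := `[< linear X /\ continuous X >].

Record dual := Dual {
  dual_fun :> V -> R^o ;
  dual_funP : dual_pred dual_fun }.

HB.instance Definition _ := [isSub for dual_fun].
HB.instance Definition _ := [Choice of dual by <:].

Lemma dual_pred_submod : subsemimod_closed dual_pred.
Proof.
split; first split.
- apply/asboolP; split; first by move=> c A B; rewrite /GRing.zero/= scaler0 addr0.
  by move=> x; exact: cvg_cst.
- move=> w w' /asboolP[lw cw] /asboolP[lw' cw']; apply/asboolP; split.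
    move=> c A B; rewrite -[LHS]/(w (c *: A + B) + w' (c *: A + B)) lw lw'.
    by rewrite addrACA -scalerDr.
  by move=> x; apply: cvgD; [exact: cw|exact: cw'].
- move=> c w /asboolP[lw cw]; apply/asboolP; split.
    move=> d A B; rewrite -[LHS]/(c *: w (d *: A + B)) lw scalerDr.
    by rewrite scalerA mulrC -scalerA.
  by move=> x; apply: cvgZr; exact: cw.
Qed.

HB.instance Definition _ :=
  GRing.isSubmodClosed.Build R (V -> R^o) dual_pred dual_pred_submod.
HB.instance Definition _ := [SubChoice_isSubLmodule of dual by <:].

Lemma dual_linear (X : dual) : linear X.
Proof. by have /asboolP[] := dual_funP X. Qed.

HB.instance Definition _ (X : dual) :=
  GRing.isLinear.Build R V R^o _ (dual_fun X) (dual_linear X).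

Lemma dual_continuous (X : dual) : continuous X.
Proof. by have /asboolP[] := dual_funP X. Qed.

Definition dual_norm (X : dual) : R :=
  sup [set `|X v| | v in [set v : V | `|v| <= 1]].

Let dual_has_sup (X : dual) : has_sup [set `|X v| | v in [set v : V | `|v| <= 1]].
Proof.
split; first by exists `|X 0|, 0 => //=; rewrite normr0.
have /linear_boundedP[M [_ H]] : bounded_near X (nbhs (0 : V)).
  exact/linear_bounded_continuous/dual_continuous.
have M1 : M < `|M| + 1 by rewrite ltr_pwDr// ler_norm.
exists (`|M| + 1) => _ [v /= v1 <-]; apply: le_trans (H _ M1 v) _.
by rewrite -[leRHS]mulr1 ler_wpM2l.
Qed.

Let dual_norm_le (X : dual) v : `|v| <= 1 -> `|X v| <= dual_norm X.
Proof. by move=> v1; apply: ub_le_sup; [case: (dual_has_sup X)|exists v]. Qed.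

Let dual_norm_ge0 (X : dual) : 0 <= dual_norm X.
Proof. by apply: le_trans (@dual_norm_le X 0 _); rewrite ?normr0. Qed.

Let dual_normP (X : dual) M :
  (forall v, `|v| <= 1 -> `|X v| <= M) -> dual_norm X <= M.
Proof.
move=> H; apply: ge_sup; first by case: (dual_has_sup X).
by move=> _ [v /= v1 <-]; exact: H.
Qed.

Let dual_normD X Y : dual_norm (X + Y) <= dual_norm X + dual_norm Y.
Proof.
apply: dual_normP => v v1; rewrite (le_trans (ler_normD _ _))//.
by rewrite lerD// dual_norm_le.
Qed.

Let dual_normZ_le c X : dual_norm (c *: X) <= `|c| * dual_norm X.
Proof.
apply: dual_normP => v v1.
by rewrite [leLHS]normrM ler_wpM2l// dual_norm_le.
Qed.

Let dual_normZ c X : dual_norm (c *: X) = `|c| * dual_norm X.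
Proof.
apply/eqP; rewrite eq_le dual_normZ_le/=.
have [->|c0] := eqVneq c 0; first by rewrite normr0 mul0r dual_norm_ge0.
rewrite -ler_pdivlMl ?normr_gt0// -normfV.
by rewrite -{1}(scalerK c0 X) dual_normZ_le.
Qed.

Let dual_norm_eq0 X : dual_norm X = 0 -> X = 0.
Proof.
move=> X0; apply/val_inj/funext => v; rewrite [RHS]/=.
have [->|v0] := eqVneq v 0; first exact: linear0.
have nv : `|v| != 0 by rewrite normr_eq0.
have Xv : X (`|v|^-1 *: v) = 0.
  apply/eqP; rewrite -normr_le0 -[leRHS]X0; apply: dual_norm_le.
  by rewrite normrZ ger0_norm ?invr_ge0// mulVf.
have := dual_linear X `|v| (`|v|^-1 *: v) 0.
by rewrite scalerA divff// scale1r Xv scaler0 linear0 !addr0.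
Qed.

HB.instance Definition _ := Lmodule_isNormed.Build R dual
  dual_normD dual_normZ dual_norm_eq0.

End dual.

(* B is the completion of V for the norm N, with canonical embedding iota (which
   is injective as soon as N is a norm); this determines (B, iota) up to a unique
   isometric isomorphism. *)
Definition is_completion (R : realType) (V : lmodType R) (N : V -> R)
    (B : completeNormedModType R) (iota : {linear V -> B}) : Prop :=
  (forall A, `|iota A| = N A) /\ dense (range iota).

Definition is_topological_isomorphism (R : realType) (V W : normedModType R)
    (f : {linear V -> W}) : Prop :=
  continuous f /\
  exists h : W -> V, [/\ cancel f h, cancel h f & continuous h].

(* Main.v *)
Require Import Defs.
From HB Require Import structures.
From mathcomp Require Import all_boot all_order all_algebra sesquilinear.
From mathcomp Require Import all_classical all_reals all_analysis.
From mathcomp Require Import ring.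

(** The map [Psi] is the pullback [X |-> X \o iota] of functionals along the
    embedding of the Dirac chains in their completion.  Everything follows from
    the fact that [bnorm] is the gauge of the absolutely convex hull of the
    difference chains of weight 1, whereas the norm of a form is its supremum
    over these same chains.

    A difference chain of weight 1 is its own decomposition, so that its norm is
    at most 1 ([bnorm_unit_terms]); hence the form norm of [X \o iota] is at most
    the dual norm of [X].  Conversely, a form [w] bounded by [M] on the chains of
    weight 1 is bounded by [M] times the weight on every difference chain, by
    homogeneity, then by [M] times the total weight of any decomposition of [A],
    so that [`|w A| <= M * bnorm A] ([form_le_bnorm]).  Two consequences: the
    inequality for [w = X \o iota] extends by density from the range of [iota] to
    all of [B], which makes the pullback an isometry ([norm_pullback]); and every
    bounded form extends to a continuous functional on [B] ([dense_extension]),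
    which makes it surjective.  A surjective linear isometry is a topological
    isomorphism.  The pullback is the only map with the prescribed values on the
    chains [(p; a)] since these span the Dirac chains.

    The extension is built by the formula of McShane,
    [X v = sup_A (w A - M * `|v - iota A|)], which directly gives a function on
    [B] that is within [M * `|v - iota A|] of each [w A]; density then forces it
    to be linear. *)

Import Order.TTheory GRing.Theory Num.Theory.
Import numFieldNormedType.Exports.

Local Open Scope classical_set_scope.
Local Open Scope ring_scope.

Set Implicit Arguments.
Unset Strict Implicit.

(** * Difference chains *)

Section difference_chains.
Variables (R : realType) (n k : nat) (g : {dot 'rV[R]_n for idfun}).
Implicit Types (f : 'rV[R]_n -> kvector R n k) (u p : 'rV[R]_n).
Implicit Types (sigma : seq 'rV[R]_n) (a : kvector R n k) (U : set 'rV[R]_n).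

Lemma DeltaZ c sigma f : Delta sigma (c *: f) = c *: Delta sigma f.
Proof.
elim: sigma f => //= u sigma IH f; rewrite -IH; congr (Delta _ _).
by rewrite /Delta1 scalerBr.
Qed.

Lemma Delta_0 sigma : Delta sigma (0 : 'rV[R]_n -> kvector R n k) = 0.
Proof. by rewrite -(scale0r 0) DeltaZ !scale0r. Qed.

Lemma elemZ c p a : elem p (c *: a) = c *: elem p a.
Proof.
apply/funext => x; rewrite /elem /GRing.scale/=.
by case: ifP => _; rewrite ?scaler0.
Qed.

Lemma termZ c sigma p a : term (sigma, p, c *: a) = c *: term (sigma, p, a).
Proof. by rewrite /term/= elemZ DeltaZ. Qed.

Lemma vnorm_eq0 u : vnorm g u = 0 -> u = 0.
Proof.
move=> /eqP; rewrite sqrtr_eq0 leNgt => gu.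
by apply: contraNeq gu => /(@neq0_dnorm_gt0 _ _ _ g).
Qed.

Lemma vnorm_ge0 u : 0 <= vnorm g u.
Proof. exact: sqrtr_ge0. Qed.

Lemma list_norm_ge0 sigma : 0 <= list_norm g sigma.
Proof. by apply: prodr_ge0 => u _; exact: vnorm_ge0. Qed.

(** A list of norm 0 contains the zero vector, and the difference along the zero
    vector kills every chain.  So the chains of weight 0, which cannot be scaled
    to weight 1, are all zero. *)
Lemma Delta_list_norm_eq0 sigma f : list_norm g sigma = 0 -> Delta sigma f = 0.
Proof.
elim: sigma f => [|u sigma IH] f; rewrite /list_norm ?big_nil ?big_cons.
  by move=> /eqP; rewrite oner_eq0.
move=> /eqP; rewrite mulf_eq0 => /orP[/eqP/vnorm_eq0->|/eqP/IH] /=; last exact.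
rewrite [Delta1 _ _](_ : _ = 0) ?Delta_0//.
rewrite /Delta1 (_ : translate 0 f = f) ?subrr//.
by apply/funext => x; rewrite /translate subr0.
Qed.

Lemma supp_Delta_finite sigma f :
  finite_set (supp f) -> finite_set (supp (Delta sigma f)).
Proof.
elim: sigma f => //= u sigma IH f ff; apply: IH.
apply: (@sub_finite_set _ _ (((fun x => x + u) @` supp f) `|` supp f)).
  move=> x fx; have [f0|f0] := eqVneq (f x) 0; last by right.
  left; exists (x - u); last by rewrite subrK.
  by move: fx; rewrite /supp/= -[Delta1 u f x]/(f (x - u) - f x) f0 subr0.
by rewrite finite_setU; split=> //; exact: finite_image.
Qed.

(** Singletons are convex, so the hull of the support of [(p; a)] is at most
    [p]. *)
Lemma inside_elem U p a : U p -> inside U (elem p a).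
Proof.
move=> Up x /(_ [set p])-> //; split=> [y z l|y].
  rewrite !inE => -> ->; exact: (@convmm R (convex_lmodType 'rV[R]_n) l p).
by rewrite /supp/= /elem; have [-> _|_ /eqP//] := eqVneq y p.
Qed.

Lemma insideZ U c f : inside U f -> inside U (c *: f).
Proof.
move=> fU x hx; apply: fU => C [cC Csub]; apply: hx; split=> // y cfy.
apply: Csub; apply: contra_neq cfy => /= fy.
by rewrite /GRing.scale/= fy scaler0.
Qed.

(** A decomposition of a chain consists of functions on the whole space; this
    puts its terms back among the chains, where a form can be evaluated. *)
Lemma term_dchain U t : inside U (term t) ->
  exists A : dchain k U, (A : 'rV[R]_n -> kvector R n k) = term t.
Proof.
move=> tU; suff tA : dchain_pred U (term t) by exists (DChain tA).
apply/asboolP; split.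
  apply: supp_Delta_finite; apply: (@sub_finite_set _ _ [set t.1.2]) => //.
  by move=> x; rewrite /supp/= /elem; have [->|_ /eqP] := eqVneq x t.1.2.
by move=> x tx; apply: tU => C [_]; exact.
Qed.

End difference_chains.

(** * The norm of chains against the norm of forms *)

Section chain_norm.
Variables (R : realType) (n k r : nat) (g : {dot 'rV[R]_n for idfun}).
Variable U : set 'rV[R]_n.
Implicit Types (A : dchain k U).
Implicit Types (s : seq (seq 'rV[R]_n * 'rV[R]_n * kvector R n k)).

Definition decomposition A s : Prop :=
  {in s, forall t, (size t.1.1 <= r)%N /\ inside U (term t)} /\
  (A : 'rV[R]_n -> kvector R n k) = \sum_(t <- s) term t.

Definition weight (t : seq 'rV[R]_n * 'rV[R]_n * kvector R n k) : R :=
  list_norm g t.1.1 * mass g t.2.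

Lemma weight_ge0 t : 0 <= weight t.
Proof. by rewrite mulr_ge0 ?list_norm_ge0 ?mass_ge0. Qed.

(** The terms [(p; A p)], with no difference taken, do: they lie in [U] because
    the support of [A] does.  In particular the infimum in [bnorm] is over a
    nonempty set, without which it would carry no lower bound. *)
Lemma decomposition_exists A : exists s, decomposition A s.
Proof.
have /asboolP[/finite_seqP[s As] AU] := dchain_funP A.
exists [seq ([::], p, dchain_fun A p) | p <- undup s]; split.
  move=> _ /mapP[p ps ->]; split=> //; apply: inside_elem; apply: AU.
  by rewrite As /= -mem_undup.
rewrite big_map; apply/funext => x; rewrite fct_sumE.
have [xs|xs] := boolP (x \in undup s).
  rewrite (bigD1_seq x) ?undup_uniq//= big1 => [|p px].
    by rewrite addr0 /term/= /elem eqxx.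
  by rewrite /term/= /elem eq_sym (negPf px).
rewrite big_seq big1 => [|p ps].
  apply/eqP/negPn/negP => Ax; have : supp A x by [].
  by rewrite As /= -mem_undup (negPf xs).
by rewrite /term/= /elem; case: eqP => // xp; rewrite -xp (negPf xs) in ps.
Qed.

Lemma bnorm_le_weight A s :
  decomposition A s -> bnorm g r A <= \sum_(t <- s) weight t.
Proof.
move=> As; apply: ge_inf; last by exists s.
by exists 0 => _ [s' _ <-]; apply: sumr_ge0 => t _; exact: weight_ge0.
Qed.

Lemma le_bnorm A M :
  (forall s, decomposition A s -> M <= \sum_(t <- s) weight t) ->
  M <= bnorm g r A.
Proof.
move=> H; apply: lb_le_inf; last by move=> _ [s As <-]; exact: H.
by have [s As] := decomposition_exists A; exists (\sum_(t <- s) weight t), s.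
Qed.

Lemma bnorm_unit_terms j A : (j <= r)%N -> unit_terms g j A -> bnorm g r A <= 1.
Proof.
move=> jr [sigma [p [a [sj AE tU w1]]]].
have := @bnorm_le_weight A [:: (sigma, p, a)].
rewrite big_seq1 /weight w1; apply; split; last by rewrite big_seq1.
by move=> t; rewrite inE => /eqP ->; rewrite sj.
Qed.

Section bounded_on_unit_terms.
Variables (w : {linear dchain k U -> R^o}) (M : R).
Hypothesis wM : forall j A, (j <= r)%N -> unit_terms g j A -> `|w A| <= M.

(** Scale the difference chain by the inverse of its weight to reach weight 1,
    where the bound is assumed; if the weight is 0, the chain is zero because the
    mass is a norm and by [Delta_list_norm_eq0]. *)
Lemma form_le_weight A t : (size t.1.1 <= r)%N -> inside U (term t) ->
  (A : 'rV[R]_n -> kvector R n k) = term t -> `|w A| <= M * weight t.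
Proof.
case: t => [[sigma p] a] /= sr tU AE.
have [w0|w0] := eqVneq (weight (sigma, p, a)) 0.
  rewrite (_ : A = 0) ?linear0 ?normr0 ?w0 ?mulr0//.
  apply/val_inj; rewrite /= AE.
  move: w0 => /eqP; rewrite /weight mulf_eq0 => /orP[|] /eqP /=.
    exact: Delta_list_norm_eq0.
  by move=> /mass_eq0 ->; rewrite -(scale0r 0) termZ scale0r.
set c := weight _ in w0 *.
have c0 : 0 < c by rewrite lt_neqAle eq_sym w0 weight_ge0.
have : `|w (c^-1 *: A)| <= M.
  apply: (wM sr); exists sigma, p, (c^-1 *: a); split=> //.
  - by rewrite termZ -AE.
  - by rewrite termZ; exact: insideZ.
  - by rewrite massZ gtr0_norm ?invr_gt0// mulrCA mulVf.
by rewrite linearZ normrM gtr0_norm ?invr_gt0// ler_pdivrMl// mulrC.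
Qed.

Lemma form_le_sum_weight s A :
  decomposition A s -> `|w A| <= M * \sum_(t <- s) weight t.
Proof.
elim: s A => [|t s IH] A [sU AE].
  rewrite (_ : A = 0) ?linear0 ?normr0 ?big_nil ?mulr0//; apply/val_inj.
  by rewrite /= AE big_nil.
have [tr tU] := sU t (mem_head _ _).
have [T TE] := term_dchain tU.
have -> : A = T + (A - T) by rewrite addrC subrK.
rewrite linearD big_cons mulrDr (le_trans (ler_normD _ _))// lerD//.
  exact: form_le_weight.
apply: IH; split; first by move=> t' t's; apply: sU; rewrite inE t's orbT.
have -> : dchain_fun (A - T) = dchain_fun A - dchain_fun T by [].
by rewrite AE TE big_cons addrC addKr.
Qed.

Lemma form_le_bnorm A : 0 <= M -> `|w A| <= M * bnorm g r A.
Proof.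
(* For [0 < M], divide by [M] to take the infimum over the decompositions. *)
rewrite le0r => /predU1P[M0|M0].
  have [s /form_le_sum_weight] := decomposition_exists A.
  by rewrite M0 !mul0r.
rewrite -ler_pdivrMl//; apply: le_bnorm => s As.
by rewrite ler_pdivrMl// form_le_sum_weight.
Qed.

End bounded_on_unit_terms.
End chain_norm.

(** * Dense extension and isometries *)

Section dual_norm.
Variables (R : realType) (V : normedModType R).
Implicit Types X : dual V.

Lemma dual_norm_ub X v : `|v| <= 1 -> `|X v| <= `|X|.
Proof.
move=> v1; apply: ub_le_sup; last by exists v.
have /linear_boundedP[M [_ H]] : bounded_near X (nbhs (0 : V)).
  exact/linear_bounded_continuous/dual_continuous.
have M1 : M < `|M| + 1 by rewrite ltr_pwDr// ler_norm.
exists (`|M| + 1) => _ [u /= u1 <-]; apply: le_trans (H _ M1 u) _.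
by rewrite -[leRHS]mulr1 ler_wpM2l.
Qed.

Lemma dual_norm_lub X M : (forall v, `|v| <= 1 -> `|X v| <= M) -> `|X| <= M.
Proof.
move=> H; apply: ge_sup; first by exists `|X 0|, 0 => //=; rewrite normr0.
by move=> _ [v /= v1 <-]; exact: H.
Qed.

End dual_norm.

Section extension.
Variables (R : realType) (V : lmodType R) (B : normedModType R).
Variables (iota : {linear V -> B}) (w : {linear V -> R^o}) (M : R).
Hypothesis iota_dense : dense (range iota).
Hypothesis M_ge0 : 0 <= M.
Hypothesis w_le : forall A, `|w A| <= M * `|iota A|.

Lemma dense_range_near (v : B) e : 0 < e -> exists A, `|v - iota A| < e.
Proof.
move=> e0; have [|x [+ [A _ Ax]]] := iota_dense (O := ball v e) _ (ball_open v e).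
  by exists v; exact: ballxx.
by rewrite -Ax -ball_normE; exists A.
Qed.

(** Any [M]-Lipschitz extension of [w] takes such a value [y] at [v].  By density
    [y] is unique, and the condition passes to linear combinations, so that the
    extension may be chosen point by point. *)
Definition is_extension_value (v : B) (y : R) : Prop :=
  forall A, `|y - w A| <= M * `|v - iota A|.

(** The condition says that [y] lies in all the intervals centered at [w A] with
    radius [M * `|v - iota A|].  They meet pairwise by the triangle inequality,
    as [`|w A' - w A| <= M * `|iota A' - iota A|], and pairwise meeting intervals
    of the line have a common point: the supremum of their lower ends. *)
Lemma extension_value_exists v : exists y, is_extension_value v y.
Proof.
pose L := [set w A - M * `|v - iota A| | A in [set: V]].
have ub A : ubound L (w A + M * `|v - iota A|).
  move=> _ [A' _ <-]; rewrite lerBlDr -addrA -mulrDr -lerBlDl.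
  rewrite -linearB (le_trans (ler_norm _))// (le_trans (w_le _))//.
  rewrite ler_wpM2l// linearB (le_trans _ (ler_normB _ _))//.
  by rewrite opprB [leRHS](congr1 _ (addrC _ _)) addrA subrK.
exists (sup L) => A; rewrite ler_distl; apply/andP; split.
  by apply: ub_le_sup; [exists (w A + M * `|v - iota A|); exact: ub | exists A].
by apply: ge_sup; [exists (w A - M * `|v - iota A|), A | exact: ub].
Qed.

(** With [A] close to [v] and [A'] close to [v'], both [z] and [c * y + y'] are
    close to [w (c *: A + A')]. *)
Lemma extension_value_lin c v v' y y' z : is_extension_value v y ->
  is_extension_value v' y' -> is_extension_value (c *: v + v') z ->
  z = c * y + y'.
Proof.
move=> vy vy' vz; apply/eqP; rewrite -subr_eq0 -normr_le0.
apply/ler_addgt0Pr => e e0; rewrite add0r.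
(* If [A] and [A'] are within [d] of [v] and [v'], then [z] and [c * y + y'] are
   each within [M * (`|c| + 1) * d] of [w (c *: A + A')].  The summand 1 only
   makes [K] positive. *)
pose K := M * (`|c| + 1) *+ 2 + 1.
have K0 : 0 < K by rewrite ltr_wpDl// mulrn_wge0// mulr_ge0// addr_ge0.
have [A vA] := dense_range_near v (divr_gt0 e0 K0).
have [A' vA'] := dense_range_near v' (divr_gt0 e0 K0).
have -> : z - (c * y + y') =
    (z - w (c *: A + A')) - (c * (y - w A) + (y' - w A')).
  have -> : w (c *: A + A') = c * w A + w A' :> R by exact: linearP.
  by ring.
have dE : c *: v + v' - iota (c *: A + A') =
    c *: (v - iota A) + (v' - iota A').
  by rewrite linearD linearZ/= scalerBr opprD addrACA.
have d_le : `|c| * `|v - iota A| + `|v' - iota A'| <= (`|c| + 1) * (e / K).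
  by rewrite mulrDl mul1r lerD ?ler_wpM2l// ltW.
rewrite (le_trans (ler_normB _ _))//.
rewrite (@le_trans _ _ (M * ((`|c| + 1) * (e / K)) *+ 2))//.
  rewrite mulr2n lerD//.
    rewrite (le_trans (vz _))// ler_wpM2l// dE.
    by rewrite (le_trans (ler_normD _ _))// normrZ.
  rewrite (le_trans (ler_normD _ _))// normrM.
  rewrite (le_trans (lerD (ler_wpM2l _ (vy A)) (vy' A')))//.
  by rewrite mulrCA -mulrDr ler_wpM2l.
rewrite mulrA -mulrnAl mulrCA ger_pMr// ler_pdivrMr// mul1r.
by rewrite lerDl.
Qed.

Lemma dense_extension : exists X : dual B, forall A, X (iota A) = w A.
Proof.
have [X XE] := choice extension_value_exists.
have Xw A : X (iota A) = w A.
  apply/eqP; rewrite -subr_eq0 -normr_le0 (le_trans (XE _ A))//.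
  by rewrite subrr normr0 mulr0.
have lX : linear (X : B -> R^o).
  by move=> c v v'; apply: extension_value_lin (XE _) (XE _) (XE _).
pose Xl : {linear B -> R^o} := HB.pack (X : B -> R^o)
  (GRing.isLinear.Build _ _ _ _ _ lX).
suff cX : continuous (X : B -> R^o).
  by have dX : dual_pred (X : B -> R^o); [exact/asboolP | exists (Dual dX)].
(* At [A = 0] the condition reads [`|X v| <= M * `|v|]. *)
apply: (linear_bounded_continuous Xl).1; apply/linear_boundedP.
exists M; split; first exact: ger0_real.
move=> N MN v.
have w0 : w 0 = 0 :> R by exact: linear0.
have := XE v 0; rewrite w0 linear0 !subr0 => /le_trans; apply.
by rewrite ler_wpM2r// ltW.
Qed.

End extension.

Section isometry.
Variables (R : realType) (V W : normedModType R) (f : {linear V -> W}).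
Hypothesis f_isometry : forall x, `|f x| = `|x|.

Lemma isometry_topological_isomorphism (h : W -> V) :
  cancel h f -> is_topological_isomorphism f.
Proof.
move=> hK; have fK : cancel f h.
  move=> x; apply/eqP; rewrite -subr_eq0 -normr_eq0 -f_isometry linearB.
  by rewrite hK subrr normr0.
split.
  move=> x; apply/cvgrPdist_lt => e e0; near=> y.
  rewrite -linearB f_isometry; near: y.
  by move: e e0; apply/cvgrPdist_lt; exact: cvg_id.
exists h; split=> // x; apply/cvgrPdist_lt => e e0; near=> y.
rewrite -f_isometry linearB !hK; near: y.
by move: e e0; apply/cvgrPdist_lt; exact: cvg_id.
Unshelve. all: by end_near.
Qed.

End isometry.

(** * Pulling functionals back to forms *)

Section pullback.
Variables (R : realType) (n k r : nat) (g : {dot 'rV[R]_n for idfun}).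
Variables (U : set 'rV[R]_n) (B : completeNormedModType R).
Variable iota : {linear dchain k U -> B}.
Hypothesis iotaB : is_completion (bnorm g r) iota.
Implicit Types X : dual B.

Lemma bform_normP (w : bform k g r U) (M : R) : 0 <= M ->
  `|w| <= M <->
  (forall j A, (j <= r)%N -> unit_terms g j A -> `|w A| <= M).
Proof. by move=> M0; rewrite -lee_fin bform_normE; exact: form_normP. Qed.

(** [iota] maps the difference chains of weight 1 into the unit ball. *)
Lemma pullback_unit_terms X j A :
  (j <= r)%N -> unit_terms g j A -> `|X (iota A)| <= `|X|.
Proof.
by move=> jr jA; rewrite dual_norm_ub// iotaB.1; exact: bnorm_unit_terms jA.
Qed.

Lemma pullback_pred X : bform_pred g r ((X \o iota) : dchain k U -> R^o).
Proof.
apply/asboolP; split; first exact: linearP.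
apply/form_norm_lt_pinfty; exists `|X| => // j A.
exact: pullback_unit_terms.
Qed.

Definition pullback X : bform k g r U := BForm (pullback_pred X).

Lemma pullback_linear : linear pullback.
Proof. by move=> c X Y; apply/val_inj/funext. Qed.

HB.instance Definition _ :=
  GRing.isLinear.Build R (dual B) (bform k g r U) _ pullback pullback_linear.

Lemma bform_le_norm (w : bform k g r U) A : `|w A| <= `|w| * `|iota A|.
Proof.
rewrite iotaB.1; apply: form_le_bnorm => //.
exact: (bform_normP w (normr_ge0 w)).1.
Qed.

Lemma norm_pullback X : `|pullback X| = `|X|.
Proof.
apply/eqP; rewrite eq_le; apply/andP; split.
  by apply/bform_normP => // j A; exact: pullback_unit_terms.
apply: dual_norm_lub => v v1.
suff : `|X v| <= `|pullback X| * `|v|.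
  by move=> /le_trans; apply; rewrite ler_piMr.
(* On the range of [iota] this is [bform_le_norm]; where it fails is an open set,
   which would meet the dense range if it were nonempty. *)
apply: contrapT => /negP; rewrite -ltNge => v_gt.
pose d (u : B) : R^o := `|pullback X| * `|u| - `|X u|.
pose O := d @^-1` [set x | x < 0].
have oO : open O.
  apply: open_comp; last exact: open_lt.
  move=> u _; apply: cvgB; first by apply: cvgMr; exact: norm_continuous.
  by apply: cvg_norm; exact: dual_continuous.
have [|u [+ [A _ Au]]] := iotaB.2 O _ oO.
  by exists v; rewrite /O/= subr_lt0.
rewrite -Au /O/= subr_lt0 ltNge; apply/negP/negPn.
exact: bform_le_norm (pullback X) A.
Qed.

Lemma pullback_surjective (w : bform k g r U) : exists X, pullback X = w.
Proof.
have [X XE] := dense_extension iotaB.2 (normr_ge0 w) (bform_le_norm w).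
by exists X; apply/val_inj/funext => A /=; exact: XE.
Qed.

End pullback.

Theorem theorem3p5p2 (R : realType) (n k r : nat) (hk : (k <= n)%N)
    (g : {dot 'rV[R]_n for idfun}) (U : set 'rV[R]_n) (hU : open U)
    (B : completeNormedModType R) (iota : {linear dchain k U -> B})
    (hB : is_completion (bnorm g r) iota) :
  exists Psi : {linear dual B -> bform k g r U},
    [/\ forall X (p : U) a, Psi X (dirac_elem p a) = X (iota (dirac_elem p a)),
        forall Phi : dual B -> bform k g r U,
          (forall X (p : U) a,
             Phi X (dirac_elem p a) = X (iota (dirac_elem p a))) ->
          Phi =1 Psi,
        is_topological_isomorphism Psi
      & forall X, `|Psi X| = `|X| ].
Proof.
exists (pullback hB); split=> //.
- move=> Phi PhiE X; apply/eqP; rewrite -subr_eq0; apply/eqP.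
  apply/val_inj/funext => A; rewrite [RHS]/=.
  apply: (dchain_split (bform_linear _)) => p a.
  rewrite -[LHS]/((Phi X (dirac_elem p a) : R) - X (iota (dirac_elem p a))).
  by rewrite PhiE subrr.
- have [h hK] := choice (pullback_surjective hB).
  by apply: isometry_topological_isomorphism hK; exact: norm_pullback.
- exact: norm_pullback.
Qed.
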